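(* Let $\xi$ be a real random variable and define $\varepsilon(x)=1+e^x\ln\mathbb P(\xi\le x)\in[-\infty,1]$. Assume that $\lim_{x\to+\infty}\varepsilon(x)=0$ and that there is $\delta>0$ with $\varepsilon(x)\in[-\delta^{-1},1-\delta]$ for all $x\in\mathbb R$. For each $N\ge 1$, let $\{\xi_{i,j}(s):1\le i,j\le N,\ s\ge 1\}$ be i.i.d. with the law of $\xi$, let $X(0)\in\mathbb R^N$ be an arbitrary initial configuration, and define $X_i(t+1)=\max_{1\le j\le N}\{X_j(t)+\xi_{i,j}(t+1)\}$ for $1\le i\le N$, $t\ge 0$. Let $\Phi(x)=\ln\sum_{j=1}^N e^{x_j}$ and $U_N(t,x)=N^{-1}\sum_{i=1}^N \mathbf 1_{X_i(t)>x}$. Then for all choices of initial configurations, all $k\ge 1$, all $K_N\subset\{1,\dots,N\}$ of cardinality $k$, and all $t\ge 2$, $$\big(X_j(t)-\Phi(X(t-1));\ j\in K_N\big)\ \longrightarrow\ G(0,1)^{\otimes k}\quad\text{in law as }N\to\infty,$$ where $G(0,1)$ is the standard Gumbel law with distribution function $\exp(-e^{-x})$; and moreover $$U_N\big(t,\Phi(X(t-1))+x\big)\longrightarrow u(x)=1-e^{-e^{-x}}$$ uniformly in $x\in\mathbb R$, in probability, as $N\to\infty$. *)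

(* Defs.v *)
From HB Require Import structures.
From mathcomp Require Import all_boot all_order all_algebra.
From mathcomp Require Import all_classical all_reals all_analysis.
Set Implicit Arguments. Unset Strict Implicit. Unset Printing Implicit Defensive.
Import Order.TTheory GRing.Theory Num.Theory.
Import numFieldNormedType.Exports.
Local Open Scope classical_set_scope.
Local Open Scope ring_scope.

Section defs.
Context (R : realType).

Definition cdf d (T : measurableType d) (P : probability T R) (Y : T -> R)
  (x : R) : R := fine (P [set w | Y w <= x]).

Definition eps_fun d (T : measurableType d) (P : probability T R) (Y : T -> R)
  (x : R) : \bar R :=
  let p := cdf P Y x in if p == 0 then -oo%E else (1 + expR x * ln p)%:E.

Definition mutually_independent d (T : measurableType d) (P : probability T R)
  (I : eqType) (Y : I -> T -> R) : Prop :=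
  (forall i, measurable_fun setT (Y i)) /\
  forall (s : seq I) (B : I -> set R), uniq s -> (forall i, measurable (B i)) ->
    P (\bigcap_(i in [set` s]) (Y i @^-1` B i)) =
    (\prod_(i <- s) P (Y i @^-1` B i))%E.

(* maximum of a nonempty finite family (indices 'I_N with N = n.+1 >= 1) *)
Definition bmax n (f : 'I_n.+1 -> R) : R := \big[Num.max/ f ord0]_(j < n.+1) f j.

(* the max-plus process: X(0) = x0,
   X_i(t+1) = max_j (X_j(t) + xi_{i,j}(t+1)), where xi_{i,j}(t+1) is
   stored as xis i j t (the time index is shifted by one). *)
Fixpoint proc T n (x0 : 'I_n.+1 -> R) (xis : 'I_n.+1 -> 'I_n.+1 -> nat -> T -> R)
  (t : nat) (w : T) : 'I_n.+1 -> R :=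
  match t with
  | 0 => x0
  | t'.+1 => fun i => bmax (fun j => proc x0 xis t' w j + xis i j t' w)
  end.

Definition Phi n (x : 'I_n.+1 -> R) : R := ln (\sum_(j < n.+1) expR (x j)).

Definition Uemp n (x : 'I_n.+1 -> R) (y : R) : R :=
  (n.+1)%:R^-1 * (#|[set i | y < x i]|)%:R.

Definition gumbel_cdf (x : R) : R := expR (- expR (- x)).
Definition u_lim (x : R) : R := 1 - gumbel_cdf x.

Definition cvg_in_law_cdf d (T : nat -> measurableType d)
  (P : forall n, probability (T n) R) k (Y : forall n, T n -> 'rV[R]_k)
  (F : 'rV[R]_k -> R) : Prop :=
  forall y : 'rV[R]_k, {for y, continuous F} ->
    (fun n => fine (P n [set w | forall i, Y n w ord0 i <= y ord0 i]))
      @ \oo --> F y.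

Definition outer_prob_to0 d (T : nat -> measurableType d)
  (P : forall n, probability (T n) R) (E : forall n, set (T n)) : Prop :=
  forall e : R, 0 < e -> \forall n \near \oo,
    exists2 A : set (T n), measurable A & (E n `<=` A /\ (P n A <= e%:E)%E).

End defs.

(* Main.v *)
Require Import Defs.
From HB Require Import structures.
From mathcomp Require Import all_boot all_order all_algebra.
From mathcomp Require Import all_classical all_reals all_analysis.
From mathcomp Require Import measurable_realfun ring lra.
Import Order.TTheory GRing.Theory Num.Theory.
Import numFieldNormedType.Exports.
Local Open Scope classical_set_scope.
Local Open Scope ring_scope.
Set Implicit Arguments.
Unset Strict Implicit.
Unset Printing Implicit Defensive.

(* Put g = 1 - eps, so that P(xi <= z) = exp (- g z e^{-z}), and let
   w_j = e^{x_j - Phi x} be the normalized weights of a configuration x.  Given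
   X(t-1) = x, the variables X_i(t) - Phi x are independent with distribution
   function exp (- e^{-y} sum_j w_j g (y - ln w_j)).  If all weights are small,
   the arguments of g are large, g is close to 1 and this is nearly the Gumbel
   distribution function; the empirical measure then follows from Chebyshev's
   inequality on a finite grid and monotonicity.

   After one step from any configuration the weights are small: since
   delta <= g <= D, the variables Z_i = e^{X_i - Phi x} have tails of order 1/u,
   so max_i Z_i = O(N), whereas each of the L dyadic levels u = 2^l contributes
   a term of order N to sum_i Z_i, for L as large as we please.  All bounds are
   uniform in x. *)

(** * Decoupling of independent noises *)

Section independence.
Local Open Scope ereal_scope.
Context (R : realType) d (T : measurableType d) (P : probability T R).

(** Pi-lambda argument, applied to one factor at a time: for a fixed event [B], the restriction of
    [P] to [B] and the multiple of [P] by [P B] are finite measures that agree on a pi-system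
    containing the whole space, hence on the sigma-algebra it generates. *)
Lemma indep_g_sigma (G1 G2 : set (set T)) :
  G1 `<=` measurable -> G2 `<=` measurable ->
  setI_closed G1 -> setI_closed G2 -> G1 setT -> G2 setT ->
  (forall A B, G1 A -> G2 B -> P (A `&` B) = P A * P B) ->
  forall A B, <<s G1 >> A -> <<s G2 >> B -> P (A `&` B) = P A * P B.
Proof.
have half (G : set (set T)) (B : set T) : G `<=` measurable -> setI_closed G ->
    G setT -> measurable B -> (forall A, G A -> P (A `&` B) = P A * P B) ->
    forall A, <<s G >> A -> P (A `&` B) = P A * P B.
  move=> mG IG GT mB GB A sA.
  have PB0 : (0 <= fine (P B))%R by exact: fine_ge0.
  pose m2 := mscale (NngNum PB0) P.
  have m2E X : m2 X = P X * P B.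
    by rewrite /m2 /mscale/= fineK ?fin_num_measure// muleC.
  rewrite -m2E.
  apply: (@g_sigma_algebra_measure_unique _ _ _ G mG (fun=> setT) _ _
    (mrestr P mB) m2) => //.
  - by rewrite bigcup_const//; exists 0%N.
  - by move=> X GX; have := GB _ GX; rewrite -m2E.
  - by move=> _; rewrite /= /mrestr setTI (le_lt_trans (probability_le1 _ mB)) ?ltry.
move=> mG1 mG2 IG1 IG2 T1 T2 H A B sA sB.
have sub (G : set (set T)) : G `<=` measurable -> <<s G >> `<=` measurable.
  by move=> mG; apply: smallest_sub => //; exact: sigma_algebra_measurable.
apply: (half G1) => //; first exact: (sub _ mG2).
move=> A' GA'; rewrite setIC muleC.
apply: (half G2) => //; first exact: mG1.
by move=> B' GB'; rewrite setIC muleC H.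
Qed.

Context (I : eqType) (Y : I -> T -> R).

(** Generates the sigma-algebra of the variables [Y i], [i] in [s]. Constraining all these variables
    at once, rather than a single one, makes the family stable under intersection. *)
Definition cylinders (s : seq I) : set (set T) :=
  [set A | exists2 B : I -> set R, (forall i, measurable (B i)) &
           A = \bigcap_(i in [set` s]) (Y i @^-1` B i)].

Lemma measurable_cylinder (s : seq I) (i : I) : i \in s ->
  measurable_fun setT (Y i : g_sigma_algebraType (cylinders s) -> R).
Proof.
move=> si _ B mB; rewrite setTI; apply: sub_sigma_algebra.
exists (fun j => if j == i then B else setT) => [j|]; first by case: ifP.
apply/seteqP; split => [w /= Bw j _|w /= /(_ i si)]; last by rewrite eqxx.
by case: eqP => // ->.
Qed.

Hypothesis Yind : mutually_independent P Y.

Lemma cylinders_measurable (s : seq I) : cylinders s `<=` measurable.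
Proof.
move=> _ [B mB ->]; apply: fin_bigcap_measurable; first exact: finite_seq.
by move=> i _; rewrite -[X in measurable X]setTI; exact: Yind.1.
Qed.

Lemma indep_cylinders (s1 s2 : seq I) (A B : set T) : uniq (s1 ++ s2) ->
  <<s cylinders s1 >> A -> <<s cylinders s2 >> B -> P (A `&` B) = P A * P B.
Proof.
move=> us.
have CI s : setI_closed (cylinders s).
  move=> _ _ [B1 mB1 ->] [B2 mB2 ->].
  exists (fun i => B1 i `&` B2 i) => [i|]; first exact: measurableI.
  by rewrite -bigcapI.
have CT s : cylinders s setT.
  exists (fun=> setT) => //.
  by apply/seteqP; split => // w _ i _.
apply: indep_g_sigma => //; [exact: cylinders_measurable..|].
move=> _ _ [B1 mB1 ->] [B2 mB2 ->].
(* [C] merges the two families of constraints. As [s1] and [s2] are disjoint, it restricts to [B1]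
   on [s1] and to [B2] on [s2], and the product rule over [s1 ++ s2] applies. *)
pose C i := if i \in s1 then B1 i else B2 i.
have mC i : measurable (C i) by rewrite /C; case: ifP.
have [u1 /hasPn s12 u2] := and3P (eqbLR (cat_uniq _ _) us).
have C2 i : i \in s2 -> C i = B2 i by move=> /s12 /negbTE; rewrite /C => ->.
have C1 i : i \in s1 -> C i = B1 i by rewrite /C => ->.
have -> : \bigcap_(i in [set` s1]) Y i @^-1` B1 i =
    \bigcap_(i in [set` s1]) Y i @^-1` C i.
  by apply: eq_bigcapr => i /= /C1 ->.
have -> : \bigcap_(i in [set` s2]) Y i @^-1` B2 i =
    \bigcap_(i in [set` s2]) Y i @^-1` C i.
  by apply: eq_bigcapr => i /= /C2 ->.
rewrite -bigcap_setU.
have -> : [set` s1] `|` [set` s2] = [set` s1 ++ s2].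
  by apply/seteqP; split => i /=; rewrite mem_cat => /orP.
by rewrite !Yind.2// big_cat.
Qed.

(* Fubini for the image of [P] under [w |-> (w, w)], where each factor carries
   the sigma-algebra generated by one of the two independent subfamilies. *)
Lemma decoupling (s1 s2 : seq I) (us : uniq (s1 ++ s2))
  (C : set (g_sigma_algebraType (cylinders s1) *
            g_sigma_algebraType (cylinders s2))) : measurable C ->
  P [set w | C (w, w)] = \int[P]_w P [set w' | C (w, w')] /\
  measurable_fun setT ((fun w => P [set w' | C (w, w')]) : T -> \bar R).
Proof.
move=> mC.
have sub s : <<s cylinders s >> `<=` measurable.
  apply: smallest_sub; [exact: sigma_algebra_measurable|exact: cylinders_measurable].
have mid s : measurable_fun setT (id : T -> g_sigma_algebraType (cylinders s)).
  by move=> _ A mA; rewrite setTI; exact: (sub s).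
pose S1 := g_sigma_algebraType (cylinders s1).
pose S2 := g_sigma_algebraType (cylinders s2).
(* The identity of [T], seen as a measurable map to the same set with a smaller sigma-algebra. *)
pose f1 : {mfun T >-> S1} :=
  HB.pack (id : T -> S1) (isMeasurableFun.Build _ _ _ _ _ (mid s1)).
pose f2 : {mfun T >-> S2} :=
  HB.pack (id : T -> S2) (isMeasurableFun.Build _ _ _ _ _ (mid s2)).
pose f12 : {mfun T >-> (S1 * S2)%type} := HB.pack (fun w => (f1 w, f2 w))
  (isMeasurableFun.Build _ _ _ _ _ (measurable_fun_pair (mid s1) (mid s2))).
(* By independence the joint law and the product law agree on rectangles, which determine the
   product measure. *)
have E : (distribution P f1 \x distribution P f2) C = distribution P f12 C.
  apply: product_measure_unique => // A B mA mB.
  exact: (indep_cylinders us mA mB).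
have F : measurable_fun setT (distribution P f2 \o xsection C).
  exact: measurable_fun_xsection.
have G w : (distribution P f2 \o xsection C) w = P [set w' | C (w, w')].
  rewrite /= /distribution /pushforward; congr (P _).
  by apply/seteqP; split => w' /=; rewrite /xsection/= inE.
have F' : measurable_fun setT ((fun w => P [set w' | C (w, w')]) : T -> \bar R).
  rewrite (_ : (fun w => _) = (distribution P f2 \o xsection C) \o id).
    exact: (measurableT_comp F (mid s1)).
  by apply/funext => w; rewrite -G.
split=> //.
transitivity (distribution P f12 C); first by [].
rewrite -E /product_measure1 ge0_integral_distribution//.
  by apply: eq_integral => w _; rewrite /= -G.
Qed.

End independence.

(** * Approximate conditioning and integrals of indicators *)

Section probability_estimates.
Local Open Scope ereal_scope.
Context (R : realType) d (T : measurableType d) (P : probability T R).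

(** The slice probability is within [e] of [c] on [A] and lies in [[0, 1]] off [A], a set of
    probability at most [e]; hence its integral is within [e + e] of [c]. *)
Lemma decoupling_approx (I : eqType) (Y : I -> T -> R)
    (Yind : mutually_independent P Y) (s1 s2 : seq I) (us : uniq (s1 ++ s2))
    (C : set (g_sigma_algebraType (cylinders Y s1) *
              g_sigma_algebraType (cylinders Y s2)))
    (A : set T) (c e : R) :
  measurable C -> measurable A -> (0 <= c <= 1)%R -> (0 <= e)%R ->
  P (~` A) <= e%:E ->
  (forall w, A w -> `|fine (P [set w' | C (w, w')]) - c| <= e)%R ->
  (`|fine (P [set w | C (w, w)]) - c| <= e + e)%R.
Proof.
move=> mC mA /andP[c0 c1] e0 PA H.
have [-> mf] := decoupling Yind us mC.
have sub : <<s cylinders Y s2 >> `<=` d.-measurable.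
  apply: smallest_sub; [exact: sigma_algebra_measurable|].
  exact: (cylinders_measurable Yind).
have mslice w : d.-measurable [set w' | C (w, w')].
  have := sub _ (measurable_xsection w mC); rewrite xsectionE; exact.
have mCA : measurable (~` A) by exact: measurableC.
have f0 w : 0 <= P [set w' | C (w, w')] by [].
have f1 w : P [set w' | C (w, w')] <= 1 by exact: probability_le1.
have ffin w : P [set w' | C (w, w')] \is a fin_num by exact: fin_num_measure.
have mi : measurable_fun setT (EFin \o (\1_(~` A) : T -> R)).
  exact/measurable_EFinP.
have i0 w : setT w -> 0 <= (EFin \o (\1_(~` A) : T -> R)) w.
  by rewrite /= lee_fin.
have ub : \int[P]_w P [set w' | C (w, w')] <= (c + (e + e))%:E.
  apply: (@le_trans _ _ (\int[P]_w ((c + e)%:E + (EFin \o \1_(~` A)) w))).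
    apply: ge0_le_integral => //.
    - by apply: emeasurable_funD => //; exact: measurable_cst.
    move=> w _ /=; rewrite indicE in_setC.
    case: (boolP (w \in A)) => [/set_mem /H|_] /=.
      by rewrite adde0 -[X in X <= _]fineK// lee_fin ler_norml; lra.
    by rewrite (le_trans (f1 w))// -EFinD lee_fin; lra.
  rewrite ge0_integralD//; last by move=> w _; rewrite lee_fin addr_ge0.
  rewrite integral_cst//= probability_setT mule1 integral_indic// setIT.
  by rewrite [in leRHS]addrA [leRHS]EFinD leeD2l.
(* The lower bound is stated additively, so that only nonnegative functions are integrated. *)
have lb : c%:E <= \int[P]_w P [set w' | C (w, w')] + (e + e)%:E.
  apply: (@le_trans _ _ (\int[P]_w (P [set w' | C (w, w')] +
      (e%:E + (EFin \o \1_(~` A)) w)))).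
    rewrite -[leLHS]mule1 -(probability_setT P) -integral_cst//.
    apply: ge0_le_integral => //.
    - by do 2!apply: emeasurable_funD => //.
    move=> w _ /=; rewrite indicE in_setC.
    case: (boolP (w \in A)) => [/set_mem /H|] /=.
      by rewrite adde0 -[X in _ <= X + _]fineK// -EFinD lee_fin ler_norml; lra.
    move=> _; rewrite (@le_trans _ _ 1)// ?lee_fin//.
    by rewrite (@le_trans _ _ (e%:E + 1))// ?leeDr// -EFinD lee_fin; lra.
  rewrite ge0_integralD//; last 2 first.
    by move=> w _; rewrite adde_ge0// lee_fin.
    by apply: emeasurable_funD => //; exact: measurable_cst.
  rewrite leeD2l// ge0_integralD//.
  rewrite integral_cst//= probability_setT mule1 integral_indic// setIT.
  by rewrite EFinD leeD2l.
have Ifin : \int[P]_w P [set w' | C (w, w')] \is a fin_num.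
  by rewrite ge0_fin_numE ?integral_ge0// (le_lt_trans ub)// ltry.
move: ub lb; rewrite -(fineK Ifin) -EFinD !lee_fin ler_norml /= => ub lb.
by apply/andP; split; lra.
Qed.

Lemma integral_sum_indic (J : Type) (s : seq J) (c : J -> R) (F : J -> set T) :
  (forall j, 0 <= c j)%R -> (forall j, measurable (F j)) ->
  \int[P]_w (\sum_(j <- s) c j * \1_(F j) w)%:E =
  (\sum_(j <- s) c j * fine (P (F j)))%:E.
Proof.
move=> c0 mF.
under eq_integral do rewrite -sumEFin.
rewrite ge0_integral_sum//.
- rewrite -sumEFin; apply: eq_bigr => j _.
  under eq_integral do rewrite EFinM.
  rewrite ge0_integralZl_EFin//.
    by rewrite integral_indic// setIT EFinM fineK ?fin_num_measure.
  by apply/measurable_EFinP.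
- by move=> j; apply/measurable_EFinP; apply: measurable_funM.
- by move=> j w _; rewrite lee_fin mulr_ge0.
Qed.

End probability_estimates.

(** * Weak law of large numbers *)

Lemma measurable_ler_set (R : realType) d (T : measurableType d) (f g : T -> R) :
  measurable_fun setT f -> measurable_fun setT g ->
  measurable [set w | f w <= g w].
Proof.
by move=> mf mg; rewrite -[X in measurable X]setTI; exact: measurable_fun_le.
Qed.

Section weak_law.
Context (R : realType) d (T : measurableType d) (P : probability T R).

(** Integrate the pointwise inequality: with nonnegative coefficients, monotonicity and additivity
    of the integral come without integrability conditions. *)
Lemma sum_indic_le (J J' : Type) (s : seq J) (c : J -> R) (F : J -> set T)
    (s' : seq J') (c' : J' -> R) (F' : J' -> set T) :
  (forall j, 0 <= c j) -> (forall j, measurable (F j)) ->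
  (forall j, 0 <= c' j) -> (forall j, measurable (F' j)) ->
  (forall w, \sum_(j <- s) c j * \1_(F j) w <= \sum_(j <- s') c' j * \1_(F' j) w) ->
  \sum_(j <- s) c j * fine (P (F j)) <= \sum_(j <- s') c' j * fine (P (F' j)).
Proof.
move=> c0 mF c'0 mF' H; rewrite -lee_fin -!integral_sum_indic//.
apply: ge0_le_integral => //.
- by move=> w _; rewrite lee_fin sumr_ge0// => j _; rewrite mulr_ge0.
- by apply/measurable_EFinP; apply: measurable_sum => j; apply: measurable_funM.
- by apply/measurable_EFinP; apply: measurable_sum => j; apply: measurable_funM.
- by move=> w _; rewrite lee_fin.
Qed.

Lemma measurable_count (n : nat) (E : 'I_n.+1 -> set T) (b a : R) :
  (forall i, measurable (E i)) ->
  measurable [set w | b <= `|\sum_i \1_(E i) w - a|].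
Proof.
move=> mE; apply: measurable_ler_set => //.
apply: (measurableT_comp (@normr_measurable _ _)).
apply: (@measurable_funB _ _ _ _ (fun w => \sum_i \1_(E i) w) (cst a)) => //.
by apply: measurable_sum => i; exact: measurable_indic.
Qed.

(** Chebyshev's inequality: by pairwise independence the variance of the count is [N p (1 - p)],
    which is at most [N]. *)
Lemma count_deviation (n : nat) (E : 'I_n.+1 -> set T) (p eta : R) :
  (forall i, measurable (E i)) -> 0 < eta ->
  (forall i, P (E i) = p%:E) ->
  (forall i j, i != j -> P (E i `&` E j) = (p * p)%:E) ->
  (P [set w | (eta * n.+1%:R <= `|\sum_i \1_(E i) w - n.+1%:R * p|)%R] <=
    ((n.+1%:R * eta ^+ 2)^-1)%:E)%E.
Proof.
move=> mE eta0 PE PEE; set N : R := n.+1%:R; set bad := [set w | _].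
have N0 : 0 < N by rewrite ltr0n.
have mbad : measurable bad by exact: measurable_count.
have p0 : 0 <= p by rewrite -lee_fin -(PE ord0).
have p1 : p <= 1 by rewrite -lee_fin -(PE ord0) probability_le1.
(* Integrate [(eta N)^2 1_bad + 2 N p S <= S^2 + (N p)^2], where [S] is the number
   of events that occur; both sides are nonnegative combinations of indicators. *)
pose F (j : option 'I_n.+1) := if j is Some i then E i else bad.
pose c (j : option 'I_n.+1) := if j is Some i then 2 * N * p else (eta * N) ^+ 2.
pose F' (j : option ('I_n.+1 * 'I_n.+1)) :=
  if j is Some ij then E ij.1 `&` E ij.2 else setT.
pose c' (j : option ('I_n.+1 * 'I_n.+1)) :=
  if j is Some i then 1 else (N * p) ^+ 2.
have := @sum_indic_le _ _ (None :: map Some (index_enum 'I_n.+1)) c F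
  (None :: map Some (index_enum ('I_n.+1 * 'I_n.+1)%type)) c' F'.
rewrite !big_cons !big_map /= => /(_ _ _ _ _ _).
have -> : \sum_i 2 * N * p * fine (P (E i)) = 2 * N * p * (N * p).
  under eq_bigr do rewrite PE /=.
  by rewrite sumr_const card_ord -mulr_natl -/N; ring.
(* The [N] diagonal pairs have probability [p], all others [p * p]. *)
have Epair : \sum_(j : 'I_n.+1 * 'I_n.+1) 1 * fine (P (E j.1 `&` E j.2)) <=
    N ^+ 2 * p ^+ 2 + N * p.
  have -> : N ^+ 2 * p ^+ 2 + N * p =
      \sum_(i < n.+1) \sum_(j < n.+1) (p ^+ 2 + (i == j)%:R * p).
    have inner (i : 'I_n.+1) :
        \sum_(j < n.+1) (p ^+ 2 + (i == j)%:R * p) = N * p ^+ 2 + p.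
      rewrite big_split/= sumr_const card_ord mulr_natl (bigD1 i)//= eqxx mul1r.
      by rewrite big1 ?addr0// => j /negbTE; rewrite eq_sym => ->; rewrite mul0r.
    under eq_bigr do rewrite inner.
    by rewrite sumr_const card_ord -[RHS]mulr_natl -/N; ring.
  rewrite pair_bigA/=; apply: ler_sum => -[i j] _ /=; rewrite mul1r.
  have [->|ij] := eqVneq i j; first by rewrite setIid PE /= mul1r lerDr sqr_ge0.
  by rewrite PEE//= mul0r addr0 expr2.
rewrite probability_setT/= mulr1 => H.
have {}H : (eta * N) ^+ 2 * fine (P bad) <= N.
  suff : (eta * N) ^+ 2 * fine (P bad) + 2 * N * p * (N * p) <=
      (N * p) ^+ 2 + (N ^+ 2 * p ^+ 2 + N * p).
    have : N * p <= N by rewrite ger_pMr.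
    lra.
  apply: le_trans (H _ _ _ _ _) _; last by rewrite lerD2l.
  - by case=> [i|]/=; rewrite ?sqr_ge0// !mulr_ge0// ltW.
  - by case.
  - by case=> [i|]/=; rewrite ?sqr_ge0.
  - by case=> [i|]//=; apply: measurableI.
  move=> w; rewrite !big_cons !big_map /= indicT mulr1 -mulr_sumr.
  set S := \sum_i \1_(E i) w.
  have -> : \sum_(j : 'I_n.+1 * 'I_n.+1) 1 * \1_(E j.1 `&` E j.2) w = S ^+ 2.
    rewrite expr2 /S big_distrlr/= pair_bigA/=; apply: eq_bigr => -[i j] _ /=.
    by rewrite mul1r indicI.
  have : (eta * N) ^+ 2 * \1_bad w <= (S - N * p) ^+ 2.
    rewrite indicE; case: (boolP (w \in bad)) => [|_]; last first.
      by rewrite mulr0 sqr_ge0.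
    rewrite inE /bad /= -/S mulr1 => h.
    by rewrite -[leRHS]real_normK ?num_real// ler_pXn2r// ?nnegrE// mulr_ge0// ltW.
  lra.
rewrite -[leLHS]fineK ?fin_num_measure// lee_fin -[leRHS]mul1r ler_pdivlMr.
  rewrite -(ler_pM2r N0) mul1r; apply: le_trans H.
  by rewrite le_eqVlt; apply/orP; left; apply/eqP; ring.
by rewrite mulr_gt0// exprn_gt0.
Qed.

End weak_law.

(** * The weights and the counting function of a configuration *)

Section max_plus.
Context (R : realType).

Lemma bmax_leP n (f : 'I_n.+1 -> R) (y : R) :
  reflect (forall j, f j <= y) (bmax f <= y).
Proof.
apply: (iffP idP) => [le_y j|le_y]; last exact: bigmax_le.
by apply: le_trans le_y; exact: le_bigmax.
Qed.

Lemma measurable_bmax d (T : measurableType d) n (f : 'I_n.+1 -> T -> R) :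
  (forall j, measurable_fun setT (f j)) ->
  measurable_fun setT (fun w => bmax (f ^~ w)).
Proof.
move=> mf; rewrite /bmax; elim: (index_enum _) => [|j r IH].
  by under eq_fun do rewrite big_nil; exact: mf.
under eq_fun do rewrite big_cons.
exact: (measurable_maxr (mf j) IH).
Qed.

Lemma measurable_Phi d (T : measurableType d) n (f : 'I_n.+1 -> T -> R) :
  (forall j, measurable_fun setT (f j)) ->
  measurable_fun setT (fun w => Phi (f ^~ w)).
Proof.
move=> mf; apply: (measurableT_comp (@measurable_ln _)).
by apply: measurable_sum => j; exact: measurableT_comp.
Qed.

Definition weight n (x : 'I_n.+1 -> R) (j : 'I_n.+1) : R := expR (x j - Phi x).

Lemma sum_expR_gt0 n (x : 'I_n.+1 -> R) : 0 < \sum_j expR (x j).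
Proof.
by rewrite big_ord_recl ltr_pwDl ?expR_gt0// sumr_ge0.
Qed.

(** Weights are invariant under a common shift of the coordinates. The centre [c] will be [0], or
    the [Phi] of the preceding configuration. *)
Lemma weightE n (x : 'I_n.+1 -> R) j (c : R) :
  weight x j = expR (x j - c) / \sum_i expR (x i - c).
Proof.
rewrite /weight expRD expRN /Phi lnK ?posrE ?sum_expR_gt0//.
under [in RHS]eq_bigr do rewrite expRD.
rewrite -mulr_suml expRD invfM mulrACA divff ?mulr1//.
by rewrite gt_eqF ?expR_gt0.
Qed.

Lemma sum_weight n (x : 'I_n.+1 -> R) : \sum_j weight x j = 1.
Proof.
under eq_bigr do rewrite (weightE _ _ 0) subr0.
rewrite -mulr_suml; under [X in _ / X]eq_bigr do rewrite subr0.
by rewrite divff// gt_eqF// sum_expR_gt0.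
Qed.

Lemma measurable_weight d (T : measurableType d) n (f : 'I_n.+1 -> T -> R) i :
  (forall j, measurable_fun setT (f j)) ->
  measurable_fun setT (fun w => weight (f ^~ w) i).
Proof.
move=> mf; apply: measurableT_comp => //.
by apply: measurable_funB => //; exact: measurable_Phi.
Qed.

Lemma mem_mksetE (T : Type) (b : T -> bool) (z : T) : (z \in [set u | b u]) = b z.
Proof. by apply/idP/idP => [/set_mem //|bz]; exact: mem_set. Qed.

(** The empirical distribution function before normalization, written as a sum of indicators so that
    the weak law applies to it. *)
Definition count_le n (x : 'I_n.+1 -> R) (y : R) : R := \sum_i (x i <= y)%R%:R.

Lemma UempE n (x : 'I_n.+1 -> R) (y : R) :
  Uemp x y = 1 - n.+1%:R^-1 * count_le x y.
Proof.
rewrite /Uemp /count_le.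
have -> : #|[set i | (y < x i)%R]%classic|%:R = \sum_i (y < x i)%R%:R :> R.
  rewrite -sum1_card natr_sum big_mkcond/=; apply: eq_bigr => i _.
  by rewrite mem_mksetE; case: (y < x i).
have -> : \sum_i (y < x i)%R%:R = n.+1%:R - \sum_i (x i <= y)%R%:R :> R.
  apply/eqP; rewrite eq_sym subr_eq -big_split/= -[n.+1 in X in X == _]card_ord.
  rewrite -sum1_card natr_sum; apply/eqP/eq_bigr => i _.
  by rewrite ltNge; case: (x i <= y) => /=; rewrite ?addr0 ?add0r.
by rewrite mulrBr mulVf// pnatr_eq0.
Qed.

Lemma measurable_count_le d (T : measurableType d) n (f : 'I_n.+1 -> T -> R)
    (h : T -> R) :
  (forall j, measurable_fun setT (f j)) -> measurable_fun setT h ->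
  measurable_fun setT (fun w => count_le (f ^~ w) (h w)).
Proof.
move=> mf mh; apply: measurable_sum => i.
rewrite (_ : (fun w => _) = \1_[set w | f i w <= h w]).
  by apply: measurable_indic; exact: measurable_ler_set.
by apply/funext => w; rewrite indicE mem_mksetE.
Qed.

(** For [b <= a <= 0], the difference is [expR a * (1 - expR (b - a))], where the first factor is at
    most [1] and the second at most [a - b]. *)
Lemma expR_lipschitz (a b : R) : a <= 0 -> b <= 0 ->
  `|expR a - expR b| <= `|a - b|.
Proof.
wlog ba : a b / b <= a => [H a0 b0|a0 b0].
  have [/H|/ltW/H] := leP b a; first exact.
  by rewrite distrC (distrC a b); apply.
rewrite !ger0_norm ?subr_ge0 ?ler_expR//.
have -> : expR a - expR b = expR a * (1 - expR (b - a)).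
  by rewrite mulrBr mulr1 -expRD; congr (_ - expR _); ring.
have := expR_ge1Dx (b - a); have := expR_ge0 a.
have : expR a <= 1 by rewrite -expR0 ler_expR.
have : expR (b - a) <= 1 by rewrite -expR0 ler_expR subr_le0.
by nra.
Qed.

(** Replace the factors one at a time; the remaining ones are bounded by [1]. *)
Lemma prod_lipschitz (I : Type) (s : seq I) (a b : I -> R) (e : R) :
  (forall i, 0 <= a i <= 1) -> (forall i, 0 <= b i <= 1) ->
  (forall i, `|a i - b i| <= e) ->
  `|\prod_(i <- s) a i - \prod_(i <- s) b i| <= (size s)%:R * e.
Proof.
move=> a01 b01 ab; elim: s => [|i s IH]; first by rewrite !big_nil subrr normr0 mul0r.
rewrite !big_cons /=.
have -> : a i * \prod_(j <- s) a j - b i * \prod_(j <- s) b j =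
  (a i - b i) * \prod_(j <- s) a j +
  b i * (\prod_(j <- s) a j - \prod_(j <- s) b j) by ring.
rewrite (le_trans (ler_normD _ _))// !normrM -natr1 mulrDl mul1r addrC lerD//.
  rewrite -[leRHS]mul1r (le_trans (ler_wpM2r _ _) (ler_wpM2l _ IH))//.
  by have /andP[b0 b1] := b01 i; rewrite ger0_norm.
rewrite -[leRHS]mulr1 ler_pM// ger0_norm ?prodr_ile1//.
by rewrite prodr_ge0// => j _; have /andP[] := a01 j.
Qed.

(** At the highest level [l] that is reached, [Z] exceeds [2 ^+ l + 2 ^+ l]: one half pays for this
    level, the other for all lower ones, which add up to at most [2 ^+ l]. *)
Lemma dyadic_sum_le (L : nat) (Z : R) : 0 <= Z ->
  \sum_(l < L) 2 ^+ l * (2 ^+ l.+1 < Z)%R%:R <= Z.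
Proof.
move=> Z0; elim: L => [|L IH]; first by rewrite big_ord0.
rewrite big_ord_recr/=; case: (boolP (2 ^+ L.+1 < Z)) => [LZ|_]; last first.
  by rewrite mulr0 addr0.
rewrite mulr1 (le_trans _ (ltW LZ))// exprS mulrDl mul1r lerD2r.
elim: L {IH LZ} => [|L IH]; first by rewrite big_ord0.
rewrite big_ord_recr/= exprS mulrDl mul1r lerD//.
by rewrite -[leRHS]mulr1 ler_wpM2l// ?exprn_ge0//; case: (_ < _).
Qed.

End max_plus.

(** * One step from a deterministic configuration *)

Section one_step.
Context (R : realType) (g : R -> R) (delta D : R).

(* [g] stands for [1 - eps]. *)
Definition noise_cdf (z : R) : R := expR (- (g z * expR (- z))).

(** Joint distribution functions are all that one step calls for, since a maximum lies below a level
    exactly when all its terms do. *)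
Definition noise_law d (T : measurableType d) (P : probability T R) n
    (Xi : 'I_n.+1 -> 'I_n.+1 -> T -> R) : Prop :=
  (forall i j, measurable_fun setT (Xi i j)) /\
  forall (s : seq ('I_n.+1 * 'I_n.+1)) (b : 'I_n.+1 * 'I_n.+1 -> R), uniq s ->
    P (\bigcap_(ij in [set` s]) [set w | Xi ij.1 ij.2 w <= b ij]) =
    (\prod_(ij <- s) noise_cdf (b ij))%:E.

Definition step (T : Type) n (Xi : 'I_n.+1 -> 'I_n.+1 -> T -> R)
    (x : 'I_n.+1 -> R) (w : T) (i : 'I_n.+1) : R :=
  bmax (fun j => x j + Xi i j w).

(** The argument of [g] is [y - ln (weight x j)]. With [g] constant equal to [1] this would be
    [gumbel_cdf y], as the weights sum to [1]. *)
Definition step_cdf n (x : 'I_n.+1 -> R) (y : R) : R :=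
  expR (- (expR (- y) * \sum_j weight x j * g (Phi x + y - x j))).

Section fixed_size.
Context d (T : measurableType d) (P : probability T R) (n : nat)
  (Xi : 'I_n.+1 -> 'I_n.+1 -> T -> R) (XiP : noise_law P Xi).

Lemma measurable_step x i : measurable_fun setT (fun w => step Xi x w i).
Proof.
apply: (@measurable_bmax _ _ _ n (fun j w => x j + Xi i j w)) => j.
by apply: measurable_funD => //; exact: XiP.1.
Qed.

Lemma measurable_step_le x i y : measurable [set w | step Xi x w i <= y].
Proof. by apply: measurable_ler_set => //; exact: measurable_step. Qed.

(** Distinct indices [i] use disjoint rows of the noise, so the probability factorizes; within a row
    the exponents add up, and [expR (- (Phi x + y i - x j))] is [expR (- y i) * weight x j]. *)
Lemma step_joint_cdf x (r : seq 'I_n.+1) (y : 'I_n.+1 -> R) : uniq r ->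
  P [set w | forall i, i \in r -> step Xi x w i <= Phi x + y i] =
  (\prod_(i <- r) step_cdf x (y i))%:E.
Proof.
move=> ur; pose s := [seq (i, j) | i <- r, j <- index_enum 'I_n.+1].
pose b (ij : 'I_n.+1 * 'I_n.+1) := Phi x + y ij.1 - x ij.2.
have -> : [set w | forall i, i \in r -> step Xi x w i <= Phi x + y i] =
    \bigcap_(ij in [set` s]) [set w | Xi ij.1 ij.2 w <= b ij].
  apply/seteqP; split=> [w H [i j] /= /allpairsP[[i' j'] /= [ir _ [-> ->]]]|w H i ir].
    by have /bmax_leP/(_ j') := H _ ir; rewrite /b/= lerBrDl.
  apply/bmax_leP => j; rewrite -lerBrDl; apply: (H (i, j)) => /=.
  by apply/allpairsP; exists (i, j); rewrite ir mem_index_enum.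
rewrite XiP.2; last first.
  by apply: allpairs_uniq => //; [exact: index_enum_uniq|move=> [? ?] [? ?]].
rewrite big_allpairs; congr (_%:E); apply: eq_bigr => i _.
rewrite /step_cdf mulr_sumr -sumrN expR_sum; apply: eq_bigr => j _.
rewrite /noise_cdf /b /weight /=; congr expR; congr (- _).
by rewrite [RHS]mulrA -expRD [RHS]mulrC; congr (_ * expR _); ring.
Qed.

Lemma step_cdfP x i y : P [set w | step Xi x w i <= Phi x + y] = (step_cdf x y)%:E.
Proof.
have := @step_joint_cdf x [:: i] (fun=> y) isT; rewrite big_seq1 => <-.
congr (P _); apply/seteqP; split=> [w /= H j|w /= H].
  by rewrite mem_seq1 => /eqP ->.
by apply: H; rewrite mem_seq1.
Qed.

Lemma step_tailP x i y :
  P [set w | Phi x + y < step Xi x w i] = (1 - step_cdf x y)%:E.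
Proof.
rewrite EFinB -(step_cdfP x i y) -probability_setC; last first.
  exact: measurable_step_le.
by congr (P _); apply/seteqP; split=> w /=; rewrite ltNge => /negP.
Qed.

Lemma step_count_deviation x y eta : 0 < eta ->
  (P [set w | (eta * n.+1%:R <=
       `|count_le (step Xi x w) (Phi x + y) - n.+1%:R * step_cdf x y|)%R] <=
   ((n.+1%:R * eta ^+ 2)^-1)%:E)%E.
Proof.
move=> eta0; pose E i := [set w | step Xi x w i <= Phi x + y].
have := @count_deviation R d T P n E (step_cdf x y) eta.
under eq_set do under eq_bigr do rewrite indicE mem_mksetE.
apply=> //.
- by move=> i; exact: measurable_step_le.
- by move=> i; exact: step_cdfP.
- move=> i j ij; have := @step_joint_cdf x [:: i; j] (fun=> y).
  rewrite big_cons big_seq1 => <-; last by rewrite /= mem_seq1 ij.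
  congr (P _); apply/seteqP; split=> [w [Ei Ej] k|w H].
    by rewrite !inE => /orP[]/eqP ->.
  by split; apply: H; rewrite !inE eqxx ?orbT.
Qed.

End fixed_size.

Context (delta0 : 0 < delta) (gbd : forall z, delta <= g z <= D).

(** The weights sum to [1], so the averaged [g] stays in [[delta, D]] whatever the configuration. *)
Lemma step_cdf_bounds n (x : 'I_n.+1 -> R) y :
  expR (- (expR (- y) * D)) <= step_cdf x y <= expR (- (expR (- y) * delta)).
Proof.
rewrite !ler_expR !lerN2 !ler_pM2l ?expR_gt0//.
rewrite -{1}[D]mul1r -[delta]mul1r -(sum_weight x) !mulr_suml.
by apply/andP; split; apply: ler_sum => j _; rewrite ler_wpM2l ?expR_ge0//;
  have /andP[] := gbd (Phi x + y - x j).
Qed.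

Lemma step_cdf01 n (x : 'I_n.+1 -> R) y : 0 <= step_cdf x y <= 1.
Proof.
rewrite expR_ge0 -expR0 ler_expR oppr_le0 mulr_ge0 ?expR_ge0//.
apply: sumr_ge0 => j _; rewrite mulr_ge0 ?expR_ge0//.
by have /andP[+ _] := gbd (Phi x + y - x j); apply: le_trans; exact: ltW.
Qed.

Lemma gumbel_cdf01 (y : R) : 0 <= gumbel_cdf y <= 1.
Proof. by rewrite expR_ge0 -expR0 ler_expR oppr_le0 expR_ge0. Qed.

Lemma step_cdf_gumbel (y e : R) : 0 < e ->
  (forall e, 0 < e -> exists A, forall z, A <= z -> `|g z - 1| <= e) ->
  exists2 eta, 0 < eta & forall n (x : 'I_n.+1 -> R),
    (forall j, weight x j <= eta) -> `|step_cdf x y - gumbel_cdf y| <= e.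
Proof.
(* The factor [expR y] in the tolerance cancels the [expR (- y)] in front of the sum. *)
move=> e0 g1; have [] := g1 (e * expR y); first by rewrite mulr_gt0 ?expR_gt0.
(* A weight at most [expR (y - A)] means that [Phi x + y - x j] is at least [A]. *)
move=> A gA; exists (expR (y - A)); first exact: expR_gt0.
move=> n x wx; apply: le_trans (expR_lipschitz _ _) _.
- rewrite oppr_le0 mulr_ge0 ?expR_ge0//.
  apply: sumr_ge0 => j _; rewrite mulr_ge0 ?expR_ge0//.
  by have /andP[+ _] := gbd (Phi x + y - x j); apply: le_trans; exact: ltW.
- by rewrite oppr_le0 expR_ge0.
set S := \sum_j _.
have -> : - (expR (- y) * S) - - expR (- y) = expR (- y) * (1 - S) by ring.
rewrite normrM (ger0_norm (expR_ge0 _)) mulrC -ler_pdivlMr ?expR_gt0//.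
rewrite expRN invrK distrC -{1}(sum_weight x) /S -sumrB.
rewrite (le_trans (ler_norm_sum _ _ _))//.
rewrite -[leRHS]mul1r -(sum_weight x) mulr_suml; apply: ler_sum => j _.
rewrite -{2}[weight x j]mulr1 -mulrBr normrM ger0_norm ?expR_ge0//.
rewrite ler_wpM2l ?expR_ge0//; apply: gA.
by have := wx j; rewrite ler_expR; lra.
Qed.

End one_step.

(** * Smallness of the weights after one step *)

Lemma union_bound (R : realType) d (T : measurableType d) (P : probability T R)
    (I : finType) (A : I -> set T) (e : R) :
  (forall i, measurable (A i)) -> (forall i, (P (A i) <= e%:E)%E) ->
  (P [set w | exists i, A i w] <= (#|I|%:R * e)%:E)%E.
Proof.
move=> mA PA.
have -> : [set w | exists i, A i w] = \big[setU/set0]_(i : I) A i.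
  rewrite -bigcup_seq; apply/seteqP; split=> [w [i Ai]|w [i _ Ai]]; exists i => //.
  by rewrite /= mem_index_enum.
have : (P (\big[setU/set0]_(i : I) A i) <= \sum_(i : I) P (A i))%E.
  elim: (index_enum I) => [|i r IH]; first by rewrite !big_nil measure0.
  rewrite !big_cons (le_trans (measureU2 _ _ _))//; last by rewrite leeD2l.
  by apply: bigsetU_measurable.
move=> /le_trans; apply.
rewrite -sum1_card natr_sum mulr_suml -sumEFin; apply: lee_sum => i _.
by rewrite mul1r.
Qed.

Lemma measurable_exists (d : measure_display) (T : measurableType d)
    (I : finType) (A : I -> set T) :
  (forall i, measurable (A i)) -> measurable [set w | exists i, A i w].
Proof.
move=> mA.
have -> : [set w | exists i, A i w] = \bigcup_(i in setT) A i.
  by apply/seteqP; split=> w [i]; exists i.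
by apply: fin_bigcup_measurable => //; exact: finite_finset.
Qed.

Lemma measurable_forall (d : measure_display) (T : measurableType d)
    (I : finType) (A : I -> set T) :
  (forall i, measurable (A i)) -> measurable [set w | forall i, A i w].
Proof.
move=> mA.
have -> : [set w | forall i, A i w] = \bigcap_(i in setT) A i.
  by apply/seteqP; split=> [w H i _|w H i]; exact: H.
by apply: fin_bigcap_measurable => //; exact: finite_finset.
Qed.

Section max_weight.
Context (R : realType) (g : R -> R) (delta D : R).
Context (delta0 : 0 < delta) (gbd : forall z, delta <= g z <= D).

Let c := delta / (2 * (1 + delta)).

Let c0 : 0 < c.
Proof. by rewrite divr_gt0// mulr_gt0// addr_gt0. Qed.

(** With [u = delta / 2 ^+ l.+1 <= delta], the tail is at least [1 - expR (- u) >= u / (1 + u) >= u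
    / (1 + delta)], and [c] is chosen so that the last term is [c / 2 ^+ l]. *)
Lemma step_tail_ge n (x : 'I_n.+1 -> R) (l : nat) :
  c / 2 ^+ l <= 1 - step_cdf g x (ln (2 ^+ l.+1)).
Proof.
have /andP[_] := step_cdf_bounds gbd x (ln (2 ^+ l.+1)).
rewrite [expR (- ln _)]expRN lnK ?posrE ?exprn_gt0//.
set u := _ * delta => q_le.
have u0 : 0 < u by rewrite mulr_gt0// invr_gt0 exprn_gt0.
have ud : u <= delta.
  by rewrite /u ger_pMl// invf_le1 ?exprn_gt0// exprn_ege1// ler1n.
have : expR (- u) <= (1 + u)^-1.
  by rewrite expRN lef_pV2 ?posrE ?expR_gt0 ?addr_gt0// expR_ge1Dx.
suff : c / 2 ^+ l <= 1 - (1 + u)^-1 by lra.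
have -> : c / 2 ^+ l = u / (1 + delta).
  by rewrite /c /u exprS !invfM; ring.
have -> : 1 - (1 + u)^-1 = u / (1 + u).
  by field; rewrite gt_eqF// addr_gt0.
by rewrite ler_pM2l// lef_pV2 ?posrE ?addr_gt0// lerD2l.
Qed.

(** Each level [l] contributes [2 ^+ l] times the number of indices above [2 ^+ l.+1], which is at
    least [N c / 2]. *)
Lemma sum_weight_ge n (x X : 'I_n.+1 -> R) (L : nat) :
  (forall l : 'I_L, `|count_le X (Phi x + ln (2 ^+ l.+1)) -
      n.+1%:R * step_cdf g x (ln (2 ^+ l.+1))| < c / 2 ^+ L.+1 * n.+1%:R) ->
  n.+1%:R * (L%:R * c / 2) <= \sum_i expR (X i - Phi x).
Proof.
move=> dev; set N : R := n.+1%:R.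
have N0 : 0 < N by rewrite ltr0n.
apply: (@le_trans _ _
    (\sum_i \sum_(l < L) 2 ^+ l * (2 ^+ l.+1 < expR (X i - Phi x))%R%:R)).
  rewrite exchange_big/=.
  have -> : N * (L%:R * c / 2) = \sum_(l < L) N * c / 2.
    by rewrite sumr_const card_ord -mulr_natl; ring.
  apply: ler_sum => l _; rewrite -mulr_sumr.
  have -> : \sum_i (2 ^+ l.+1 < expR (X i - Phi x))%R%:R =
      N - count_le X (Phi x + ln (2 ^+ l.+1)).
    have -> : N = \sum_(i < n.+1) 1 by rewrite sumr_const card_ord.
    rewrite /count_le -sumrB.
    apply: eq_bigr => i _; rewrite -lerBlDl -ler_expR lnK ?posrE ?exprn_gt0//.
    by rewrite ltNge; case: (_ <= _); rewrite /= ?subrr ?subr0.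
  have tail := step_tail_ge x l.
  (* The allowed deviation is at most half of the tail bound [c / 2 ^+ l], for every [l < L], so the
     other half remains. *)
  have h : N * (c / 2 ^+ l.+1) <= N - count_le X (Phi x + ln (2 ^+ l.+1)).
    have := dev l; rewrite ltr_norml -/N => /andP[_].
    have : c / 2 ^+ L.+1 * N <= N * (c / 2 ^+ l.+1).
      rewrite mulrC ler_pM2l// ler_pM2l// lef_pV2 ?posrE ?exprn_gt0//.
      by rewrite ler_eXn2l ?ltr1n// ltnS ltnW.
    have : N * (c / 2 ^+ l) <= N * (1 - step_cdf g x (ln (2 ^+ l.+1))).
      by rewrite ler_pM2l.
    have -> : N * (c / 2 ^+ l) = N * (c / 2 ^+ l.+1) + N * (c / 2 ^+ l.+1).
      by rewrite exprS invfM; field; rewrite expf_neq0// pnatr_eq0.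
    lra.
  have -> : N * c / 2 = 2 ^+ l * (N * (c / 2 ^+ l.+1)).
    by rewrite exprS invfM; field; rewrite expf_neq0// pnatr_eq0.
  by rewrite ler_pM2l// exprn_gt0.
by apply: ler_sum => i _; rewrite dyadic_sum_le// expR_ge0.
Qed.

(** Off an event of probability at most [e], every [expR (X i - Phi x)] is at most [M N] while their
    sum is at least [N L c / 2], so each weight is at most [2 M / (L c) <= eta]. The rank from which
    this holds depends neither on the probability space nor on [x]. *)
Lemma max_weight_small (eta e : R) : 0 < eta -> 0 < e ->
  \forall n \near \oo, forall d (T : measurableType d) (P : probability T R)
    (Xi : 'I_n.+1 -> 'I_n.+1 -> T -> R) (x : 'I_n.+1 -> R),
  noise_law g P Xi ->
  (P (~` [set w | forall i, (weight (step Xi x w) i <= eta)%R]) <= e%:E)%E.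
Proof.
move=> eta0 e0.
have D0 : 0 < D by have /andP[h1 h2] := gbd 0; exact: lt_le_trans delta0 (le_trans h1 h2).
(* With this [M], the union bound over [N] tails of size [D / (M N)] costs [e / 2]. *)
pose M := 2 * D / e.
have M0 : 0 < M by rewrite divr_gt0// mulr_gt0.
pose L := (Num.truncn (2 * M / (c * eta))).+1.
have LM : 2 * M / (c * eta) <= L%:R by rewrite ltW// truncnS_gt.
pose etaL := c / 2 ^+ L.+1.
have etaL0 : 0 < etaL by rewrite divr_gt0// exprn_gt0.
near=> n => d T P Xi x XiP.
set N : R := n.+1%:R.
have N0 : 0 < N by rewrite ltr0n.
have MN0 : 0 < M * N by exact: mulr_gt0.
(* For such [N], the [L] Chebyshev bounds add up to at most [e / 2]. *)
have NL : 2 * L%:R / (etaL ^+ 2 * e) <= N.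
  by rewrite (@le_trans _ _ n%:R)// ?ler_nat//; near: n; exact: nbhs_infty_ger.
pose A i := [set w | Phi x + ln (M * N) < step Xi x w i].
pose B (l : 'I_L) := [set w | etaL * n.+1%:R <=
  `|count_le (step Xi x w) (Phi x + ln (2 ^+ l.+1)) -
    n.+1%:R * step_cdf g x (ln (2 ^+ l.+1))|].
have mA i : measurable (A i).
  have -> : A i = ~` [set w | step Xi x w i <= Phi x + ln (M * N)].
    by apply/seteqP; split=> w /=; rewrite /A/= ltNge => /negP.
  by apply: measurableC; exact: (measurable_step_le XiP).
have mB l : measurable (B l).
  apply: measurable_ler_set => //.
  apply: (measurableT_comp (@normr_measurable _ _)).
  apply: (@measurable_funB _ _ _ _
    (fun w => count_le (step Xi x w) (Phi x + ln (2 ^+ l.+1))) (cst _)) => //.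
  apply: (@measurable_count_le _ _ _ n (fun i w => step Xi x w i)) => // j.
  exact: (measurable_step XiP).
have PA i : (P (A i) <= (D / (M * N))%:E)%E.
  rewrite (step_tailP XiP) lee_fin.
  have /andP[+ _] := step_cdf_bounds gbd x (ln (M * N)).
  rewrite [expR (- ln _)]expRN lnK ?posrE// => q_ge.
  rewrite [D / _]mulrC lerBlDl -lerBlDr.
  exact: le_trans (expR_ge1Dx _) q_ge.
have PB l : (P (B l) <= ((N * etaL ^+ 2)^-1)%:E)%E.
  exact: (step_count_deviation XiP).
apply: (@le_trans _ _ (P ([set w | exists i, A i w] `|` [set w | exists l, B l w]))).
  apply: le_measure; rewrite ?inE.
  - apply: measurableC.
    apply: measurable_forall => i.
    apply: measurable_ler_set => //.
    apply: (@measurable_weight _ _ _ n (fun i w => step Xi x w i)) => j.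
    exact: (measurable_step XiP).
  - by apply: measurableU; exact: measurable_exists.
  (* Outside all [A i] and [B l], divide the upper bound on one term by the lower bound on the
     sum. *)
  move=> w; apply: contra_notP => nAB i.
  have Zi : expR (step Xi x w i - Phi x) <= M * N.
    rewrite leNgt; apply/negP => h; apply: nAB; left; exists i.
    by rewrite /A /= addrC -ltrBrDr -ltr_expR lnK// posrE.
  have SZ : N * (L%:R * c / 2) <= \sum_i expR (step Xi x w i - Phi x).
    apply: sum_weight_ge => l; rewrite ltNge; apply/negP => h.
    by apply: nAB; right; exists l.
  rewrite (weightE _ _ (Phi x)) ler_pdivrMr; last first.
    apply: lt_le_trans SZ; apply: mulr_gt0 => //; apply: divr_gt0 => //.
    by apply: mulr_gt0 => //; rewrite ltr0n.
  apply: le_trans Zi _; apply: (@le_trans _ _ (eta * (N * (L%:R * c / 2)))); last first.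
    by rewrite ler_pM2l.
  move: LM; rewrite ler_pdivrMr ?(mulr_gt0 c0 eta0)// => LM.
  have -> : eta * (N * (L%:R * c / 2)) = (L%:R * (c * eta)) / 2 * N by ring.
  by rewrite ler_pM2r// ler_pdivlMr// mulrC.
apply: le_trans (measureU2 _ _ _) _; [exact: measurable_exists..|].
apply: le_trans (leeD (union_bound mA PA) (union_bound mB PB)) _.
rewrite -EFinD lee_fin !card_ord -/N.
have -> : N * (D / (M * N)) = e / 2.
  by rewrite /M; field; rewrite !gt_eqF.
suff : L%:R * (N * etaL ^+ 2)^-1 <= e / 2.
  by rewrite -(lerD2l (e / 2)) -splitr.
have etaL20 : 0 < etaL ^+ 2 by exact: exprn_gt0.
rewrite ler_pdivrMr; last exact: mulr_gt0.
move: NL; rewrite ler_pdivrMr; last exact: mulr_gt0.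
move=> NL.
have -> : e / 2 * (N * etaL ^+ 2) = N * (etaL ^+ 2 * e) / 2 by ring.
by rewrite ler_pdivlMr// mulrC.
Unshelve. all: end_near. Qed.

End max_weight.

(** * From a grid to uniform convergence *)

Section gumbel_grid.
Context (R : realType).

Lemma gumbel_cdf_le (a b : R) : (gumbel_cdf a <= gumbel_cdf b) = (a <= b).
Proof. by rewrite ler_expR lerN2 ler_expR lerN2. Qed.

Definition gumbel_quantile (p : R) : R := - ln (- ln p).

Lemma gumbel_quantileK (p : R) : 0 < p < 1 -> gumbel_cdf (gumbel_quantile p) = p.
Proof.
move=> /andP[p0 p1]; rewrite /gumbel_cdf opprK lnK; last first.
  by rewrite posrE oppr_gt0 ln_lt0// p0.
by rewrite opprK lnK.
Qed.

(** The [k + 1] interior quantiles that cut the range of the Gumbel distribution function into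
    [k + 2] equal pieces. *)
Definition grid_point (k : nat) (l : 'I_k.+1) : R :=
  gumbel_quantile (l.+1%:R / k.+2%:R).

Lemma grid_pointK k (l : 'I_k.+1) : gumbel_cdf (grid_point l) = l.+1%:R / k.+2%:R.
Proof.
rewrite gumbel_quantileK// divr_gt0 ?ltr0n//= ltr_pdivrMr ?ltr0n// mul1r.
by rewrite ltr_nat ltnS.
Qed.

Lemma count_le_homo n (X : 'I_n.+1 -> R) : {homo count_le X : a b / a <= b}.
Proof.
move=> a b ab; apply: ler_sum => i _; rewrite ler_nat.
by case: (leP (X i) a) => //= /le_trans /(_ ab) ->.
Qed.

Lemma count_le01 n (X : 'I_n.+1 -> R) y : 0 <= count_le X y <= n.+1%:R.
Proof.
rewrite sumr_ge0//=; have -> : n.+1%:R = \sum_(i < n.+1) (1 : R).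
  by rewrite sumr_const card_ord.
by apply: ler_sum => i _; rewrite lern1; case: (_ <= _).
Qed.

(** Both distribution functions are monotone, and the Gumbel one grows by only [1 / (k + 2)] between
    neighbouring grid points, so the error at [x] is at most that at a neighbour plus this
    increment. *)
Lemma uniform_from_grid n (X : 'I_n.+1 -> R) (c e : R) (k : nat) : 0 < e ->
  (forall l : 'I_k.+1, `|count_le X (c + grid_point l) -
     n.+1%:R * gumbel_cdf (grid_point l)| < e * n.+1%:R) ->
  forall x, `|Uemp X (c + x) - u_lim x| <= e + k.+2%:R^-1.
Proof.
move=> e0 grid x.
have [f fE] : exists f : R -> R,
    forall z, f z = n.+1%:R^-1 * count_le X (c + z) by eexists.
have [K KE] : exists K : R, K = k.+2%:R by eexists.
have [v vE] : exists v, v = gumbel_cdf x by eexists.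
have N0 : 0 < n.+1%:R :> R by rewrite ltr0n.
have K0 : 0 < K by rewrite KE ltr0n.
have fhomo a b : a <= b -> f a <= f b.
  by move=> ab; rewrite !fE ler_pM2l ?invr_gt0// count_le_homo// lerD2l.
have /andP[cl0 cl1] := count_le01 X (c + x).
have f0 : 0 <= f x by rewrite fE; apply: mulr_ge0 => //; rewrite invr_ge0 ltW.
have f1 : f x <= 1 by rewrite fE mulrC ler_pdivrMr// mul1r.
have fgrid (l : 'I_k.+1) : `|f (grid_point l) - l.+1%:R / K| < e.
  rewrite KE -grid_pointK -(ltr_pM2r N0) -{1}(ger0_norm (ltW N0)) -normrM mulrBl.
  rewrite fE mulrC mulrA divff ?gt_eqF// mul1r [X in _ - X]mulrC; exact: grid.
rewrite UempE /u_lim -fE -vE -KE.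
have -> : 1 - f x - (1 - v) = v - f x by ring.
have v0 : 0 <= v by rewrite vE expR_ge0.
have v1 : v < 1 by rewrite vE -expR0 ltr_expR oppr_lt0 expR_gt0.
(* [j] is the integer part of [K * v], so [v] lies between [j / K] and [(j + 1) / K]. *)
have /andP[] := truncn_itv (mulr_ge0 (ltW K0) v0).
move: (Num.truncn _) => j jv vj.
have jk : (j < k.+2)%N.
  by rewrite -(ltr_nat R) -KE (le_lt_trans jv)// -[ltRHS]mulr1 ltr_pM2l.
rewrite ler_norml; apply/andP; split.
  suff : f x <= v + K^-1 + e by lra.
  (* The grid point of index [j] has level [(j + 1) / K]. For [j = k + 1] there is none to the right
     of [x], and [f x <= 1] takes its place. *)
  have [jk1|kj] := ltnP j k.+1.
    have xy : x <= grid_point (Ordinal jk1).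
      by rewrite -gumbel_cdf_le grid_pointK -vE -KE ler_pdivlMr// mulrC ltW.
    apply: le_trans (fhomo _ _ xy) _.
    have := fgrid (Ordinal jk1); rewrite ltr_norml => /andP[_] /=.
    have : j.+1%:R / K <= v + K^-1.
      by rewrite -natr1 mulrDl mul1r lerD2r ler_pdivrMr// mulrC.
    lra.
  have : k.+1%:R / K <= v.
    by rewrite ler_pdivrMr// mulrC (le_trans _ jv)// ler_nat.
  have -> : k.+1%:R / K = 1 - K^-1.
    have -> : k.+1%:R = K - 1 by rewrite KE -[k.+2%:R]natr1 addrK.
    by rewrite mulrBl mul1r divff// gt_eqF.
  have : 0 < K^-1 by rewrite invr_gt0.
  lra.
suff : v - K^-1 - e <= f x by lra.
(* For [j = 0] there is no grid point to the left of [x], and [0 <= f x] takes its place. *)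
move: jk jv vj; case: j => [|j] jk jv vj.
  have : v <= K^-1 by rewrite -[leRHS]mul1r ler_pdivlMr// mulrC ltW.
  lra.
have yx : grid_point (Ordinal (jk : (j < k.+1)%N)) <= x.
  by rewrite -gumbel_cdf_le grid_pointK -vE -KE ler_pdivrMr// mulrC.
apply: le_trans (fhomo _ _ yx).
have := fgrid (Ordinal (jk : (j < k.+1)%N)); rewrite ltr_norml => /andP[+ _] /=.
have : v <= j.+1%:R / K + K^-1.
  by rewrite -[X in _ + X]mul1r -mulrDl natr1 ler_pdivlMr// mulrC ltW.
lra.
Qed.

End gumbel_grid.

(** * The process *)

Section process.
Context (R : realType).

(** Asking only for the noise before [t] lets this apply with the sigma-algebra of the past. *)
Lemma measurable_proc d (T : measurableType d) n (x0 : 'I_n.+1 -> R)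
    (xis : 'I_n.+1 -> 'I_n.+1 -> nat -> T -> R) (t : nat) :
  (forall i j s, (s < t)%N -> measurable_fun setT (xis i j s)) ->
  forall i, measurable_fun setT (fun w => proc x0 xis t w i).
Proof.
elim: t => [|t IH] mxis i /=; first exact: measurable_cst.
apply: (@measurable_bmax R _ _ n (fun j w => proc x0 xis t w j + xis i j t w)) => j.
by apply: measurable_funD; [apply: IH => *; exact/mxis/ltnW|exact: mxis].
Qed.

(** The noise of index [s] drives the step from time [s] to [s + 1], so the configuration at time
    [t] depends on the indices [s < t]. *)
Definition past_noise n (t : nat) : seq ('I_n.+1 * 'I_n.+1 * nat) :=
  [seq (p, s) | p <- index_enum ('I_n.+1 * 'I_n.+1)%type, s <- iota 0 t].

Definition current_noise n (t : nat) : seq ('I_n.+1 * 'I_n.+1 * nat) :=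
  [seq (p, t) | p <- index_enum ('I_n.+1 * 'I_n.+1)%type].

Lemma uniq_noise n t : uniq (past_noise n t ++ current_noise n t).
Proof.
rewrite cat_uniq; apply/and3P; split.
- by apply: allpairs_uniq; rewrite ?index_enum_uniq ?iota_uniq// => -[? ?] [].
- apply/hasPn => _ /mapP[p _ ->]; apply/negP => /allpairsP[[p' s] /= [_]].
  by rewrite mem_iota add0n => + [_ ts]; rewrite -ts ltnn.
- by rewrite map_inj_uniq ?index_enum_uniq// => ? ? [].
Qed.

(* The quantification over all measurable spaces expresses joint measurability
   on R^N without a sigma-algebra on function spaces. *)
Definition measurable_prop1 n (A : ('I_n.+1 -> R) -> Prop) : Prop :=
  forall d (S : measurableType d) (f : 'I_n.+1 -> S -> R),
    (forall i, measurable_fun setT (f i)) -> measurable [set z | A (f ^~ z)].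

Definition measurable_prop2 n (C : ('I_n.+1 -> R) -> ('I_n.+1 -> R) -> Prop) : Prop :=
  forall d (S : measurableType d) (f h : 'I_n.+1 -> S -> R),
    (forall i, measurable_fun setT (f i)) ->
    (forall i, measurable_fun setT (h i)) ->
    measurable [set z | C (f ^~ z) (h ^~ z)].

(** Past and current noises are independent, so the configuration at time [t] may be frozen: an
    estimate for one step from each deterministic [x] in [A] passes to the process. *)
Lemma proc_decoupling d (T : measurableType d) (P : probability T R) n
    (x0 : 'I_n.+1 -> R) (xis : 'I_n.+1 -> 'I_n.+1 -> nat -> T -> R)
    (xis_indep : mutually_independent P
      (fun ijs : 'I_n.+1 * 'I_n.+1 * nat => xis ijs.1.1 ijs.1.2 ijs.2))
    (t : nat) (A : ('I_n.+1 -> R) -> Prop)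
    (C : ('I_n.+1 -> R) -> ('I_n.+1 -> R) -> Prop) (c e : R) :
  measurable_prop1 A -> measurable_prop2 C -> 0 <= c <= 1 -> 0 <= e ->
  (P [set w | ~ A (proc x0 xis t w)] <= e%:E)%E ->
  (forall x, A x ->
    `|fine (P [set w | C x (step (fun i j => xis i j t) x w)]) - c| <= e) ->
  `|fine (P [set w | C (proc x0 xis t w) (proc x0 xis t.+1 w)]) - c| <= e + e.
Proof.
move=> mA mC c01 e0 PA H.
set Y := (fun ijs : _ => _) in xis_indep.
pose S1 := g_sigma_algebraType (cylinders Y (past_noise n t)).
pose S2 := g_sigma_algebraType (cylinders Y (current_noise n t)).
have m1 i : measurable_fun setT ((fun w => proc x0 xis t w i) : S1 -> R).
  apply: (@measurable_proc _ S1) => i' j' s st.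
  apply: (@measurable_cylinder _ _ _ _ Y _ (i', j', s)).
  by apply/allpairsP; exists ((i', j'), s); rewrite mem_index_enum mem_iota.
have m2 i j : measurable_fun setT (xis i j t : S2 -> R).
  apply: (@measurable_cylinder _ _ _ _ Y _ (i, j, t)).
  by apply/mapP; exists (i, j); rewrite ?mem_index_enum.
have m12 i : measurable_fun setT (fun z : S1 * S2 =>
    step (fun i j => xis i j t) (proc x0 xis t z.1) z.2 i).
  apply: (@measurable_bmax R _ _ n
    (fun j (z : S1 * S2) => proc x0 xis t z.1 j + xis i j t z.2)) => j.
  apply: measurable_funD.
    exact: (measurableT_comp (m1 j) measurable_fst).
  exact: (measurableT_comp (m2 i j) measurable_snd).
apply: (@decoupling_approx _ _ _ _ _ Y xis_indep _ _ (uniq_noise n t)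
  [set z | C (proc x0 xis t z.1) (step (fun i j => xis i j t) (proc x0 xis t z.1) z.2)]
  [set w | A (proc x0 xis t w)]) => //.
- apply: (mC _ (S1 * S2)%type (fun i z => proc x0 xis t z.1 i)
    (fun i z => step (fun i j => xis i j t) (proc x0 xis t z.1) z.2 i)) => // i.
  exact: (measurableT_comp (m1 i) measurable_fst).
- apply: (mA _ T (fun i w => proc x0 xis t w i)).
  by apply: measurable_proc => i j s _; exact: (xis_indep.1 (i, j, s)).
- by move=> w Aw; exact: (H (proc x0 xis t w) Aw).
Qed.

Lemma noise_law_xis d0 (T0 : measurableType d0) (P0 : probability T0 R)
    (xi : T0 -> R) (g : R -> R) d (T : measurableType d) (P : probability T R) n
    (xis : 'I_n.+1 -> 'I_n.+1 -> nat -> T -> R) (t : nat) :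
  (forall z, Defs.cdf P0 xi z = noise_cdf g z) -> measurable_fun setT xi ->
  mutually_independent P
    (fun ijs : 'I_n.+1 * 'I_n.+1 * nat => xis ijs.1.1 ijs.1.2 ijs.2) ->
  (forall i j s (B : set R), measurable B ->
     P (xis i j s @^-1` B) = P0 (xi @^-1` B)) ->
  noise_law g P (fun i j => xis i j t).
Proof.
move=> cdfE mxi ind law; split=> [i j|s b us]; first exact: (ind.1 (i, j, t)).
pose B (ijs : 'I_n.+1 * 'I_n.+1 * nat) := `]-oo, b ijs.1]%classic.
have us' : uniq [seq (ij, t) | ij <- s] by rewrite map_inj_uniq// => ? ? [].
have mB ijs : measurable (B ijs) by exact: measurable_itv.
have := ind.2 _ B us' mB; rewrite big_map => H.
transitivity (\prod_(j <- s) P ((xis j.1 j.2 t) @^-1` B (j, t)))%E.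
  rewrite -H; congr (P _); apply/seteqP; split=> [w /= K ijs /mapP[ij sij ->]|w /= K ij sij].
    by rewrite /B/= in_itv/=; exact: K.
  by have := K (ij, t) (map_f _ sij); rewrite /B/= in_itv.
rewrite -prodEFin; apply: eq_bigr => ij _; rewrite law// -cdfE /Defs.cdf fineK.
  by congr (P0 _); apply/seteqP; split=> w /=; rewrite in_itv.
apply: fin_num_measure.
by apply: measurable_ler_set => //.
Qed.

End process.

(** Take [g = 1 - eps]. The lower bound excludes the value [-oo], so the distribution function is
    positive everywhere and its logarithm can be inverted. *)
Lemma noise_law_of_eps (R : realType) d0 (T0 : measurableType d0)
    (P0 : probability T0 R) (xi : T0 -> R) (delta : R) :
  eps_fun P0 xi x @[x --> +oo] --> 0%E ->
  (forall x : R,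
     ((- delta^-1)%:E <= eps_fun P0 xi x <= (1 - delta)%:E)%E) ->
  exists g : R -> R, [/\ forall z, Defs.cdf P0 xi z = noise_cdf g z,
    forall z, delta <= g z <= 1 + delta^-1 &
    forall e : R, 0 < e -> exists A, forall z, A <= z -> `|g z - 1| <= e].
Proof.
move=> lim bd; exists (fun z => 1 - fine (eps_fun P0 xi z)); split.
- move=> z; have := bd z; rewrite /eps_fun /noise_cdf.
  have p0 : 0 <= Defs.cdf P0 xi z by exact: fine_ge0.
  case: eqP => [_ /andP[]//|/eqP pn0 _] /=.
  have p_gt0 : 0 < Defs.cdf P0 xi z by rewrite lt_neqAle eq_sym pn0.
  rewrite opprD addrA subrr add0r mulNr opprK mulrAC -expRD subrr expR0 mul1r.
  by rewrite lnK.
- move=> z; have := bd z; rewrite /eps_fun; case: eqP => [_ /andP[]//|_].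
  by rewrite !lee_fin /= => /andP[h1 h2]; apply/andP; split; lra.
- move=> e e0; have /fine_cvgP[_ /cvgrPdist_le /(_ _ e0)] := lim.
  (* Neighbourhoods of [+oo] contain open half-lines; the shift by [1] gives a closed one. *)
  case=> A [_ HA]; exists (A + 1) => z Az.
  have := HA z; rewrite sub0r normrN /= => h.
  have -> : 1 - fine (eps_fun P0 xi z) - 1 = - fine (eps_fun P0 xi z) by ring.
  by rewrite normrN; apply: h; rewrite (lt_le_trans _ Az)// ltrDl.
Qed.

Lemma step_cdf_gumbel_family (R : realType) (g : R -> R) (delta D : R)
    (I : finType) (y : I -> R) (e : R) :
  0 < delta -> (forall z, delta <= g z <= D) ->
  (forall e : R, 0 < e -> exists A, forall z, A <= z -> `|g z - 1| <= e) ->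
  0 < e ->
  exists2 zeta, 0 < zeta & forall n (x : 'I_n.+1 -> R),
    (forall j, weight x j <= zeta) ->
    forall i, `|step_cdf g x (y i) - gumbel_cdf (y i)| <= e.
Proof.
move=> delta0 gbd g1 e0.
have /choice[z zP] : forall i, exists z : R, 0 < z /\ forall n (x : 'I_n.+1 -> R),
    (forall j, weight x j <= z) -> `|step_cdf g x (y i) - gumbel_cdf (y i)| <= e.
  by move=> i; have [z z0 zP] := step_cdf_gumbel delta0 gbd (y i) e0 g1; exists z.
(* The default [1] keeps the threshold positive when [I] is empty. *)
exists (\big[Num.min/1]_i z i).
  by apply: lt_bigmin => [|i _]; [exact: ltr01|have [] := zP i].
move=> n x wx i; apply: (zP i).2 => j; apply: le_trans (wx j) _.
exact: bigmin_le_cond.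
Qed.

(** * Convergence in the limit of large size *)

Section convergence.
Context (R : realType) (g : R -> R) (delta D : R).
Context (delta0 : 0 < delta) (gbd : forall z, delta <= g z <= D).
Context (g1 : forall e : R, 0 < e -> exists A, forall z, A <= z -> `|g z - 1| <= e).

Lemma measurable_weight_le n (zeta : R) :
  measurable_prop1 (fun X : 'I_n.+1 -> R => forall i, weight X i <= zeta).
Proof.
move=> d S f mf.
apply: measurable_forall => i.
by apply: measurable_ler_set => //; exact: measurable_weight.
Qed.

Lemma step_cdf_kappa d (T : measurableType d) (P : probability T R) n k
    (Xi : 'I_n.+1 -> 'I_n.+1 -> T -> R) (kappa : 'I_k -> 'I_n.+1)
    (x : 'I_n.+1 -> R) (y : 'I_k -> R) :
  noise_law g P Xi -> injective kappa ->
  P [set w | forall i, step Xi x w (kappa i) - Phi x <= y i] =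
  (\prod_(i < k) step_cdf g x (y i))%:E.
Proof.
move=> XiP kinj.
(* [y] transported along the injection [kappa], with default [0] outside its image. *)
pose y' j := if [pick i | kappa i == j] is Some i then y i else 0.
have y'K i : y' (kappa i) = y i.
  rewrite /y'; case: pickP => [i' /eqP /kinj -> //|/(_ i)].
  by rewrite eqxx.
have := step_joint_cdf XiP x y' (r := [seq kappa i | i <- index_enum 'I_k]).
rewrite map_inj_uniq// index_enum_uniq big_map => /(_ isT).
under eq_bigr do rewrite y'K.
move=> <-; congr (P _); apply/seteqP; split=> w H.
  by move=> _ /mapP[i _ ->]; rewrite y'K -lerBlDl; exact: H.
by move=> i; rewrite lerBlDl -y'K; apply: H; rewrite map_f// mem_index_enum.
Qed.

(** Of the deviation [e + e], one [e] absorbs the distance from [step_cdf] to the Gumbel value,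
    leaving the other to Chebyshev's inequality. *)
Lemma step_count_gumbel d (T : measurableType d) (P : probability T R) n
    (Xi : 'I_n.+1 -> 'I_n.+1 -> T -> R) (x : 'I_n.+1 -> R) (I : finType)
    (y : I -> R) (e : R) :
  noise_law g P Xi -> 0 < e ->
  (forall i, `|step_cdf g x (y i) - gumbel_cdf (y i)| <= e) ->
  (P [set w | exists i, ((e + e) * n.+1%:R <=
     `|count_le (step Xi x w) (Phi x + y i) - n.+1%:R * gumbel_cdf (y i)|)%R] <=
   (#|I|%:R * (n.+1%:R * e ^+ 2)^-1)%:E)%E.
Proof.
move=> XiP e0 He.
have mstep a b i : measurable [set w | (a <=
     `|count_le (step Xi x w) (Phi x + y i) - b|)%R].
  apply: measurable_ler_set => //.
  apply: (measurableT_comp (@normr_measurable _ _)).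
  apply: (@measurable_funB _ _ _ _
    (fun w => count_le (step Xi x w) (Phi x + y i)) (cst _)) => //.
  apply: (@measurable_count_le _ _ _ n (fun i w => step Xi x w i)) => // j.
  exact: (measurable_step XiP).
apply: union_bound => i; first exact: mstep.
apply: le_trans (step_count_deviation XiP x (y i) e0).
apply: le_measure; rewrite ?inE; [exact: mstep..|].
move=> w /= h; rewrite -(lerD2r (e * n.+1%:R)) -mulrDl.
apply: (le_trans h); set q := step_cdf _ _ _.
set S := count_le _ _; set G := gumbel_cdf _.
have -> : S - n.+1%:R * G = (S - n.+1%:R * q) + (q - G) * n.+1%:R by ring.
rewrite (le_trans (ler_normD _ _))// lerD2l normrM (ger0_norm (ler0n R n.+1)).
by rewrite ler_wpM2r//; exact: He.
Qed.

Context (d : measure_display) (T : nat -> measurableType d)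
  (P : forall n, probability (T n) R)
  (xis : forall n, 'I_n.+1 -> 'I_n.+1 -> nat -> T n -> R)
  (xis_indep : forall n, mutually_independent (P n)
     (fun ijs : 'I_n.+1 * 'I_n.+1 * nat => xis n ijs.1.1 ijs.1.2 ijs.2))
  (xis_law : forall n t, noise_law g (P n) (fun i j => xis n i j t))
  (x0 : forall n, 'I_n.+1 -> R).

Lemma measurable_proc_prop2 n t
    (C : ('I_n.+1 -> R) -> ('I_n.+1 -> R) -> Prop) : measurable_prop2 C ->
  measurable [set w | C (proc (@x0 n) (@xis n) t w) (proc (@x0 n) (@xis n) t.+1 w)].
Proof.
move=> mC; apply: (mC _ (T n) (fun i w => proc (@x0 n) (@xis n) t w i)
  (fun i w => proc (@x0 n) (@xis n) t.+1 w i)).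
- by apply: measurable_proc => i j s _; exact: (xis_law n s).1.
- by apply: measurable_proc => i j s _; exact: (xis_law n s).1.
Qed.

(** The one-step bound holds from every configuration, so it transfers by decoupling with the
    trivial condition on the past and target value [0]. *)
Lemma proc_weight_small t (zeta e : R) : 0 < zeta -> 0 < e ->
  \forall n \near \oo, (P n [set w |
    ~ forall i, (weight (proc (@x0 n) (@xis n) t.+1 w) i <= zeta)%R] <= e%:E)%E.
Proof.
move=> zeta0 e0; have e20 : 0 < e / 2 by rewrite divr_gt0.
near=> n.
have small : forall x, (P n (~` [set w | forall i,
    (weight (step (fun i j => @xis n i j t) x w) i <= zeta)%R]) <= (e / 2)%:E)%E.
  move=> x; move: (xis_law n t); move: x; near: n.
  have := max_weight_small delta0 gbd zeta0 e20.
  by apply: filterS => n H x; exact: H.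
pose C (x X : 'I_n.+1 -> R) := ~ forall i, weight X i <= zeta.
have mC : measurable_prop2 C.
  move=> d' S f h mf mh; apply: measurableC; exact: measurable_weight_le.
have mCt := measurable_proc_prop2 t mC.
rewrite -[leLHS]fineK ?fin_num_measure// lee_fin.
apply: le_trans (ler_norm _) _; rewrite -[X in `|X|]subr0 [e]splitr.
apply: (@proc_decoupling R d (T n) (P n) n (@x0 n) (@xis n) (xis_indep n) t
  (fun=> True) C) => //.
- by move=> d' S f mf; rewrite [X in measurable X](_ : _ = setT)//; apply/seteqP.
- by rewrite lexx ler01.
- exact: ltW.
- rewrite [X in P n X](_ : _ = set0) ?measure0 ?lee_fin ?ltW//.
  by apply/seteqP; split=> w //=; apply.
move=> x _; rewrite subr0 ger0_norm ?fine_ge0// -lee_fin fineK; first exact: small.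
by rewrite ge0_fin_numE// (le_lt_trans (small x))// ltry.
Unshelve. all: end_near. Qed.

Lemma cvg_joint_law k (kappa : forall n, 'I_k -> 'I_n.+1) t (y : 'I_k -> R) :
  (\forall n \near \oo, injective (kappa n)) ->
  fine (P n [set w | forall i, proc (@x0 n) (@xis n) t.+2 w (kappa n i) -
                     Phi (proc (@x0 n) (@xis n) t.+1 w) <= y i]) @[n --> \oo]
  --> \prod_(i < k) gumbel_cdf (y i).
Proof.
move=> kinj; apply/cvgrPdist_le => e e0.
have e20 : 0 < e / 2 by rewrite divr_gt0.
(* Tolerance per factor: [k] of them cost at most [e / 2], and [k.+1] keeps the denominator
   nonzero. *)
have e3 : 0 < e / 2 / k.+1%:R by rewrite divr_gt0.
have [zeta zeta0 zetaP] := step_cdf_gumbel_family y delta0 gbd g1 e3.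
have := proc_weight_small t zeta0 e20; apply: filterS2 kinj => n kinj PA.
rewrite distrC [e]splitr.
apply: (@proc_decoupling R d (T n) (P n) n (@x0 n) (@xis n) (xis_indep n) t.+1
  (fun X => forall i, weight X i <= zeta)
  (fun x X => forall i, X (kappa n i) - Phi x <= y i)) => //.
- exact: measurable_weight_le.
- move=> d' S f h mf mh.
  apply: (measurable_forall
    (A := fun i => [set z | h (kappa n i) z - Phi (f ^~ z) <= y i])) => i.
  apply: measurable_ler_set => //.
  by apply: measurable_funB => //; exact: measurable_Phi.
- rewrite prodr_ile1 ?prodr_ge0//= => [i _|i _]; last exact: gumbel_cdf01.
  by have /andP[] := gumbel_cdf01 (y i).
- exact: ltW.
move=> x wx; rewrite (step_cdf_kappa _ _ (xis_law n t.+1) kinj)/=.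
apply: le_trans (prod_lipschitz _ _ _ (zetaP n x wx)) _.
- by move=> i; exact: (step_cdf01 delta0 gbd).
- by move=> i; exact: gumbel_cdf01.
have -> : size (index_enum 'I_k) = k by rewrite -[RHS]card_ord cardT enumT.
by rewrite mulrC mulrAC ler_pdivrMr// ler_pM2l// ler_nat.
Qed.

(** The event quantifies over all real [x]; it is covered by a measurable event about finitely many
    grid points, whose probability is then bounded. *)
Lemma cvg_empirical t (eta : R) : 0 < eta ->
  outer_prob_to0 P (fun n => [set w | exists x : R,
    eta < `| Uemp (proc (@x0 n) (@xis n) t.+2 w)
               (Phi (proc (@x0 n) (@xis n) t.+1 w) + x) - u_lim x |]).
Proof.
move=> eta0 e e0.
have e20 : 0 < e / 2 by rewrite divr_gt0.
(* Budget for [eta]: a quarter for the fluctuations, a quarter for the distance from [step_cdf] to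
   the Gumbel law, a half for the grid spacing. *)
have eta4 : 0 < eta / 4 by rewrite divr_gt0.
pose k := Num.truncn (2 / eta).
have kP : k.+2%:R^-1 <= eta / 2.
  rewrite -[eta / 2]invrK lef_pV2 ?posrE ?invr_gt0 ?divr_gt0//.
  rewrite invf_div (le_trans (ltW (truncnS_gt _)))// ler_nat.
  exact: leqnSn.
have [zeta zeta0 zetaP] :=
  step_cdf_gumbel_family (@grid_point R k) delta0 gbd g1 eta4.
near=> n.
have PA : (P n [set w | ~ forall i,
    (weight (proc (@x0 n) (@xis n) t.+1 w) i <= zeta)%R] <= (e / 2)%:E)%E.
  by near: n; exact: proc_weight_small.
have nbig : k.+1%:R / ((eta / 4) ^+ 2 * (e / 2)) <= n.+1%:R.
  by rewrite (@le_trans _ _ n%:R)// ?ler_nat//; near: n; exact: nbhs_infty_ger.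
pose C (x X : 'I_n.+1 -> R) := exists l : 'I_k.+1,
  (eta / 4 + eta / 4) * n.+1%:R <= `|count_le X (Phi x + grid_point R l) -
    n.+1%:R * gumbel_cdf (grid_point R l)|.
have mC : measurable_prop2 C.
  move=> d' S f h mf mh.
  apply: (measurable_exists (A := fun l : 'I_k.+1 => [set z |
    (eta / 4 + eta / 4) * n.+1%:R <=
      `|count_le (h ^~ z) (Phi (f ^~ z) + grid_point R l) -
        n.+1%:R * gumbel_cdf (grid_point R l)|])) => l.
  apply: measurable_ler_set => //.
  apply: (measurableT_comp (@normr_measurable _ _)).
  apply: (@measurable_funB _ _ _ _
    (fun z => count_le (h ^~ z) (Phi (f ^~ z) + grid_point R l)) (cst _)) => //.
  apply: (@measurable_count_le _ _ _ n h
    (fun z => Phi (f ^~ z) + grid_point R l)) => //.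
  apply: measurable_funD => //; exact: measurable_Phi.
have mCt := measurable_proc_prop2 t.+1 mC.
exists [set w | C (proc (@x0 n) (@xis n) t.+1 w) (proc (@x0 n) (@xis n) t.+2 w)].
  exact: mCt.
split=> [w [x]|].
  apply: contraPP => nC; apply/negP; rewrite -leNgt.
  apply: (le_trans (uniform_from_grid (e := eta / 2) (k := k) _ _ _)).
  - by rewrite divr_gt0.
  - move=> l; rewrite ltNge; apply/negP => h; apply: nC; exists l.
    have -> : eta / 4 + eta / 4 = eta / 2 by field.
    exact: h.
  by rewrite [leRHS]splitr lerD2l.
rewrite -[leLHS]fineK ?fin_num_measure// lee_fin.
apply: le_trans (ler_norm _) _; rewrite -[X in `|X|]subr0 [e]splitr.
apply: (@proc_decoupling R d (T n) (P n) n (@x0 n) (@xis n) (xis_indep n) t.+1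
  (fun X => forall i, weight X i <= zeta) C) => //.
- exact: measurable_weight_le.
- by rewrite lexx ler01.
- exact: ltW.
move=> x wx; rewrite subr0 ger0_norm ?fine_ge0//.
have h := step_count_gumbel (xis_law n t.+1) eta4 (zetaP n x wx).
rewrite -lee_fin fineK; last first.
  by rewrite ge0_fin_numE// (le_lt_trans h)// ltry.
apply: le_trans h _; rewrite lee_fin card_ord.
have N0 : 0 < n.+1%:R :> R by rewrite ltr0n.
have eta42 : 0 < (eta / 4) ^+ 2 by exact: exprn_gt0.
rewrite ler_pdivrMr; last exact: mulr_gt0.
move: nbig; rewrite ler_pdivrMr; last exact: mulr_gt0.
by move=> nbig; rewrite mulrCA [e / 2 * _]mulrC.
Unshelve. all: end_near. Qed.

End convergence.

Unset Implicit Arguments.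

Theorem theorem1p2 (R : realType) (d0 d : measure_display)
  (T0 : measurableType d0) (P0 : probability T0 R) (xi : T0 -> R)
  (Hxi : measurable_fun setT xi)
  (Hlim : eps_fun P0 xi x @[x --> +oo] --> 0%E)
  (delta : R) (Hdelta : 0 < delta)
  (Hbd : forall x : R,
     ((- delta^-1)%:E <= eps_fun P0 xi x <= (1 - delta)%:E)%E)
  (T : nat -> measurableType d) (P : forall n, probability (T n) R)
  (xis : forall n, 'I_n.+1 -> 'I_n.+1 -> nat -> T n -> R)
  (Hind : forall n, mutually_independent (P n)
     (fun ijs : 'I_n.+1 * 'I_n.+1 * nat => xis n ijs.1.1 ijs.1.2 ijs.2))
  (Hlaw : forall n i j s (B : set R), measurable B ->
     P n (xis n i j s @^-1` B) = P0 (xi @^-1` B))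
  (x0 : forall n, 'I_n.+1 -> R)
  (k : nat) (Hk : (1 <= k)%N) (kappa : forall n, 'I_k -> 'I_n.+1)
  (Hkappa : \forall n \near \oo, injective (kappa n))
  (t : nat) (Ht : (2 <= t)%N) :
  cvg_in_law_cdf P
    (fun n w => \row_(i < k) (proc (x0 n) (xis n) t w (kappa n i)
                               - Phi (proc (x0 n) (xis n) t.-1 w)))
    (fun y => \prod_(i < k) gumbel_cdf (y ord0 i))
  /\
  (forall eta : R, 0 < eta ->
    outer_prob_to0 P (fun n => [set w | exists x : R,
      eta < `| Uemp (proc (x0 n) (xis n) t w)
                    (Phi (proc (x0 n) (xis n) t.-1 w) + x) - u_lim x |])).
Proof.
have [g [cdfE gbd g1]] := noise_law_of_eps Hlim Hbd.
have law n s : noise_law g (P n) (fun i j => xis n i j s).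
  exact: (noise_law_xis s cdfE Hxi (Hind n) (Hlaw n)).
(* Since [t >= 2], the configuration at time [t.-1] has undergone at least one step, so its weights
   are small. *)
case: t Ht => [|[|t]] // _; split.
  move=> y _ /=.
  have := @cvg_joint_law _ _ _ _ Hdelta gbd g1 _ _ _ _ Hind law x0 k kappa t
    (fun i => y ord0 i) Hkappa.
  apply: cvg_trans; apply: near_eq_cvg; apply: nearW => n /=.
  congr (fine (P n _)).
  by apply/seteqP; split=> w /= H i; move: (H i); rewrite mxE.
by move=> eta eta0; exact: (cvg_empirical Hdelta gbd g1 Hind law).
Qed.
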